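(* Let $(f_n)_{n\in\mathbb N}$ and $(g_n)_{n\in\mathbb N}$ be countable dense sequences in $C[0,1]$, and let $p,p'\in(0,1)$. Suppose that graphs sampled from $\mathrm{LARG}(\{f_n\},p)$ and $\mathrm{LARG}(\{g_n\},p')$ are almost surely isomorphic. Then there exist a homeomorphism $\psi$ of $[0,1]$ onto itself and a permutation $i\mapsto n_i$ of $\mathbb N$ such that one of the following holds: (1) for all $i,j$ and all $x\in[0,1]$, if $f_i(x)>f_j(x)$ then $g_{n_i}(\psi(x))\ge g_{n_j}(\psi(x))$; or (2) for all $i,j$ and all $x\in[0,1]$, if $f_i(x)>f_j(x)$ then $g_{n_i}(\psi(x))\le g_{n_j}(\psi(x))$.
   Context: $C[0,1]$ is the Banach space of continuous real functions on $[0,1]$ with the sup norm $\|\cdot\|$. For countable $V\subseteq C[0,1]$ and $p\in(0,1)$, $\mathrm{LARG}(V,p)$ is the random graph on $V$ in which each pair $u\neq v$ with $\|u-v\|<1$ is joined independently with probability $p$, and no other pairs are joined.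
   Formalization: The sequences (f_n) and (g_n) are assumed to have no repeated terms, since with repetitions the claimed permutation of indices can fail to exist; ''almost surely isomorphic'' is read for two independent samples. *)

(* Defs.v *)
From HB Require Import structures.
From mathcomp Require Export all_boot all_order all_algebra.
From mathcomp Require Export all_classical all_reals all_analysis.

Set Implicit Arguments.
Unset Strict Implicit.
Unset Printing Implicit Defensive.

Import Order.TTheory GRing.Theory Num.Theory.
Import numFieldNormedType.Exports.

Local Open Scope classical_set_scope.
Local Open Scope ring_scope.

(* [0,1] as a type, with the topology induced from R. *)
Definition unit_interval (R : realType) := set_type `[(0 : R), (1 : R)]%classic.
HB.instance Definition _ (R : realType) := Topological.on (unit_interval R).

Definition C01 (R : realType) := continuousType (unit_interval R) R.
HB.instance Definition _ (R : realType) := Choice.on (C01 R).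

Definition supnorm (R : realType) (h : unit_interval R -> R) : R :=
  sup (range (fun x => `|h x|)).

(* ||u - v||; the difference is taken pointwise as C01 carries no ring or
   module structure in the library. *)
Definition C01_dist (R : realType) (u v : C01 R) : R :=
  supnorm (fun x => u x - v x).

Definition C01_dense (R : realType) (V : set (C01 R)) : Prop :=
  forall (u : C01 R) (e : R), 0 < e -> exists2 v, V v & C01_dist v u < e.

Definition homeomorphism (X Y : topologicalType) (h : X -> Y) : Prop :=
  continuous h /\
  exists k : Y -> X, [/\ continuous k, cancel h k & cancel k h].

Section LARG.
Context (R : realType).

Definition larg_pair (V : set (C01 R)) (e : C01 R * C01 R) : Prop :=
  [/\ V e.1, V e.2, e.1 != e.2 & C01_dist e.1 e.2 < 1].

(* No unordered pair is listed twice, in either orientation. *)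
Definition distinct_pairs (s : seq (C01 R * C01 R)) : bool :=
  pairwise (fun e e' => (e != e') && (e != (e'.2, e'.1))) s.

Definition edge_event (T : Type) (G : T -> rel (C01 R)) (e : C01 R * C01 R) :
    set T :=
  [set w | G w e.1 e.2].

(* G is a random graph with law LARG(V, p), given by its random adjacency
   relation on C[0,1], which is supported on pairs of vertices in V. *)
Definition is_LARG (d : measure_display) (T : measurableType d)
    (P : probability T R) (V : set (C01 R)) (p : R)
    (G : T -> rel (C01 R)) : Prop :=
  [/\ (forall w, symmetric (G w)),
      (forall w u v, G w u v -> larg_pair V (u, v)),
      (forall e, larg_pair V e -> measurable (edge_event G e)),
      (forall e, larg_pair V e -> P (edge_event G e) = p%:E)
    & (forall s : seq (C01 R * C01 R),
         (forall e, e \in s -> larg_pair V e) -> distinct_pairs s ->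
         P (\bigcap_(e in [set` s]) edge_event G e) =
         (\prod_(e <- s) P (edge_event G e))%E)].

Definition graph_iso (V : set (C01 R)) (E : rel (C01 R))
    (W : set (C01 R)) (F : rel (C01 R)) : Prop :=
  exists phi : C01 R -> C01 R, set_bij V W phi /\
    forall u v, V u -> V v -> E u v = F (phi u) (phi v).

(* Independent samples, realized on a product space.  The almost-everywhere
   quantifier only asks that the exceptional set be contained in a measurable
   null set: the event itself need not be measurable. *)
Definition as_isomorphic (d1 d2 : measure_display)
    (T1 : measurableType d1) (T2 : measurableType d2)
    (P1 : probability T1 R) (P2 : probability T2 R)
    (V : set (C01 R)) (G : T1 -> rel (C01 R))
    (W : set (C01 R)) (H : T2 -> rel (C01 R)) : Prop :=
  {ae (P1 \x P2)%E, forall w : T1 * T2, graph_iso V (G w.1) W (H w.2)}.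

End LARG.

(* Main.v *)
(** The graph alone determines the relation [dist u v < 2]: almost surely two
distinct vertices have a common neighbour exactly when they are at distance
less than 2, since each of infinitely many candidate midpoints works
independently with probability p^2.  By density, chains of such steps recover
[dist u v < 2k] for all k, so an isomorphism maps the balls of radius 2k onto
each other.

Call a set of vertices a horoball if each of its finite subsets lies in a ball
contained in the set.  The half-spaces [u x > t] and [u x < t] are horoballs,
and by compactness every proper horoball is contained in one of them.
Half-spaces attached to different pairs (point, sign) are incomparable, so the
half-spaces are exactly the proper horoballs whose proper horoball supersets
form a chain.  Hence an isomorphism permutes half-spaces, and this induces a
permutation of the pairs (point, sign).  The sign is constant by the
intermediate value theorem, and the map on points is continuous because the
sets [u > v], for u, v in the dense family, form a base of the topology. *)

Require Import Defs.
From mathcomp Require Import ring lra.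

Import Order.TTheory GRing.Theory Num.Theory.
Import numFieldNormedType.Exports.

Local Open Scope classical_set_scope.
Local Open Scope ring_scope.

Set Implicit Arguments.
Unset Strict Implicit.

(** * Continuous functions on the compact interval *)

Section unit_interval.
Context (R : realType).
Local Notation K := (unit_interval R).

Lemma sval_continuous : continuous (fun x : K => sval x).
Proof. exact: (@initial_continuous K R (fun x : K => sval x)). Qed.

Lemma sval_itv (x : K) : 0 <= sval x <= 1.
Proof. by case: x => r /= /set_mem; rewrite /= in_itv. Qed.

Lemma clamp_subproof (r : R) :
  Num.max 0 (Num.min 1 r) \in (`[(0 : R), (1 : R)]%classic : set R).
Proof.
by apply/mem_set; rewrite /= in_itv /= le_max lexx /= ge_max ler01 ge_min lexx.
Qed.

(** The retraction of the line onto the interval; through it compactness and the intermediate value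
    theorem pass from real segments to [K]. *)
Definition clamp (r : R) : K :=
  exist (fun s : R => s \in (`[(0 : R), (1 : R)]%classic : set R)) _
    (clamp_subproof r).

Lemma svalK (x : K) : clamp (sval x) = x.
Proof.
have /andP[x0 x1] := sval_itv x.
apply/val_inj; rewrite /= min_r // max_r //.
Qed.

Lemma clamp_continuous : continuous clamp.
Proof.
apply: (@continuous_comp_initial K R R (fun x : K => sval x)) => r.
apply: (@continuous_max R R (fun=> 0) (fun r => Num.min 1 r)).
  exact: cvg_cst.
apply: (@continuous_min R R (fun=> 1) id); [exact: cvg_cst|exact: cvg_id].
Qed.

Lemma unit_interval_compact : compact [set: K].
Proof.
rewrite (_ : setT = clamp @` `[(0 : R), 1]).
  apply: continuous_compact; last exact: segment_compact.
  by apply: continuous_subspaceT => r; exact: clamp_continuous.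
apply/seteqP; split=> // x _; exists (sval x); last exact: svalK.
by rewrite /= in_itv /= sval_itv.
Qed.

Lemma nbhs_sval (x : K) (N : set K) : nbhs x N ->
  exists2 e : R, 0 < e & forall y : K, `|sval y - sval x| < e -> N y.
Proof.
case=> U /= [[W oW <-]] /= Wx sub.
have /nbhs_ballP[e e0 He] : nbhs (sval x) W by apply: open_nbhs_nbhs.
exists e => // y xy; apply: sub; apply: He.
by rewrite -ball_normE /= distrC.
Qed.

Lemma unit_interval_cover (I : choiceType) (D : set I) (Q : I -> set K) :
  (forall i, D i -> open (Q i)) -> (forall x, exists2 i, D i & Q i x) ->
  exists s : seq I, (forall i, i \in s -> D i) /\
    (forall x, exists2 i, i \in s & Q i x).
Proof.
move=> oQ cov; have := @segment_compact R 0 1; rewrite compact_cover.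
move=> /(_ I D (fun i => clamp @^-1` Q i)) [i Di|r _|s sD sc].
- apply: open_comp; last exact: oQ.
  by move=> r _; exact: clamp_continuous.
- by have [i] := cov (clamp r); exists i.
exists (finmap.enum_fset s); split=> [i /sD /set_mem //|x].
have [|i /= si Qi] := sc (sval x); first by rewrite /= in_itv /= sval_itv.
by exists i => //; rewrite /= svalK in Qi.
Qed.

Lemma max_unit_interval (h : K -> R) : continuous h ->
  exists c, forall x, h x <= h c.
Proof.
move=> ch.
have [||c _ hc] := @compact_EVT_max K R h setT _ unit_interval_compact.
- by exists (clamp 0).
- exact: continuous_subspaceT.
by exists c => x; apply: hc; rewrite inE.
Qed.

Lemma nonvanishing_same_sign (h : K -> R) : continuous h ->
  (forall x, h x != 0) -> forall x y, (0 < h x) = (0 < h y).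
Proof.
move=> ch h0.
suff H x y : sval x <= sval y -> (0 < h x) = (0 < h y).
  by move=> x y; have [/H//|/ltW/H] := leP (sval x) (sval y).
move=> xy; apply: contrapT => /eqP neq.
have : exists2 c, c \in `[sval x, sval y] & h (clamp c) = 0.
  apply: IVT => //.
    apply: continuous_subspaceT => r.
    by apply: continuous_comp; [exact: clamp_continuous|exact: ch].
  rewrite !svalK ge_min le_max; move: (h0 x) (h0 y) neq.
  by case: (ltgtP (h x) 0); case: (ltgtP (h y) 0).
by case=> c _ /eqP; rewrite (negPf (h0 _)).
Qed.

Lemma continuous_normr (h : K -> R) : continuous h ->
  continuous (fun x => `|h x|).
Proof. by move=> ch x; exact: (@cvg_norm R R K (nbhs x) _ h _ (ch x)). Qed.

Lemma continuous_add (h k : K -> R) : continuous h -> continuous k ->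
  continuous (fun x => h x + k x).
Proof.
by move=> ch ck x; exact: (@cvgD R R K (nbhs x) _ h k _ _ (ch x) (ck x)).
Qed.

Lemma continuous_sub (h k : K -> R) : continuous h -> continuous k ->
  continuous (fun x => h x - k x).
Proof.
by move=> ch ck x; exact: (@cvgB R R K (nbhs x) _ h k _ _ (ch x) (ck x)).
Qed.

Lemma continuous_mulr (h : K -> R) (c : R) : continuous h ->
  continuous (fun x => c * h x).
Proof.
move=> ch x.
by apply: (@cvgM R K (nbhs x) _ (fun=> c) h _ _ _ (ch x)); exact: cvg_cst.
Qed.

Lemma continuous_minr (h k : K -> R) : continuous h -> continuous k ->
  continuous (fun x => Num.min (h x) (k x)).
Proof. by move=> ch ck x; exact: (@continuous_min R K h k x (ch x) (ck x)). Qed.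

Lemma continuous_const (c : R) : continuous ((fun=> c) : K -> R).
Proof. exact: cst_continuous. Qed.

Lemma C01_continuous (u : C01 R) : continuous u.
Proof. exact: (@cts_fun _ _ u). Qed.

(** By compactness the supremum is attained at some [m], so even the strict bound can be tested
    pointwise. *)
Lemma C01_dist_lt (u v : C01 R) (c : R) :
  C01_dist u v < c <-> forall x, `|u x - v x| < c.
Proof.
have cd : continuous (fun x : K => `|u x - v x|).
  by apply/continuous_normr/continuous_sub; exact: C01_continuous.
have [m hm] := max_unit_interval cd.
suff -> : C01_dist u v = `|u m - v m|.
  by split=> // + x; apply: le_lt_trans; exact: hm.
apply/eqP; rewrite eq_le; apply/andP; split.
  by apply: sup_le_ub => [|_ [x _ <-]]; [exists `|u m - v m|, m|exact: hm].
apply: ub_le_sup; first by exists `|u m - v m| => _ [x _ <-]; exact: hm.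
by exists m.
Qed.

End unit_interval.

(** * Horoballs and half-spaces of a dense family *)

Section horoballs.
Context (R : realType) (I : choiceType).
Local Notation K := (unit_interval R).
Implicit Types (E : I -> I -> Prop) (H : set I) (f : I -> C01 R).
Implicit Types (d : K * bool) (t : R).

Definition dense_family f := forall (u : K -> R) (e : R), continuous u ->
  0 < e -> exists i, forall x, `|f i x - u x| < e.

(** The threshold is 2, the distance detected by common neighbours; every index is related to
    itself. *)
Definition unit_graph E f :=
  forall i j, E i j <-> forall x, `|f i x - f j x| < 2.

(* [reach E k a] is the ball of radius [k + 1] around [a] in the graph [E]. *)
Fixpoint reach E (k : nat) (i j : I) : Prop :=
  if k is k'.+1 then exists l, E i l /\ reach E k' l j else E i j.

Definition horoball E H := forall s : seq I, (forall i, i \in s -> H i) ->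
  exists a k, (forall i, i \in s -> reach E k a i) /\
              (forall i, reach E k a i -> H i).

(** Phrased through [E] alone, so two families with the same unit graph have the same such sets. *)
Definition halfspace_like E H :=
  [/\ horoball E H, exists i, ~ H i &
      forall H1 H2, horoball E H1 -> (exists i, ~ H1 i) ->
        horoball E H2 -> (exists i, ~ H2 i) ->
        H `<=` H1 -> H `<=` H2 -> H1 `<=` H2 \/ H2 `<=` H1].

(* A pair [(x, b)] stands for evaluation at [x], negated when [b] is false. *)
Definition sg (b : bool) (r : R) : R := if b then r else - r.
Definition ev d (u : K -> R) : R := sg d.2 (u d.1).
Definition opp d : K * bool := (d.1, ~~ d.2).
Definition half f d t : set I := [set i | t < ev d (f i)].

Lemma sgK b : involutive (sg b).
Proof. by case: b => r //=; rewrite opprK. Qed.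

Lemma sgB b (r s : R) : sg b r - sg b s = sg b (r - s).
Proof. by case: b => //=; rewrite opprB opprK addrC. Qed.

Lemma norm_sg b (r : R) : `|sg b r| = `|r|.
Proof. by case: b => //=; rewrite normrN. Qed.

Lemma ev_opp d (u : K -> R) : ev (opp d) u = - ev d u.
Proof. by case: d => x [] //=; rewrite /ev /= opprK. Qed.

Lemma oppK : involutive opp.
Proof. by case=> x []. Qed.

Lemma continuous_sg b (h : K -> R) : continuous h ->
  continuous (fun x => sg b (h x)).
Proof.
move=> ch; case: b => //=.
rewrite (_ : (fun x => - h x) = (fun x => -1 * h x)).
  exact: continuous_mulr.
by apply/funext => x; rewrite mulN1r.
Qed.

Context (f : I -> C01 R) (f_dense : dense_family f).

(** Lower bounds in two non-opposite directions can be met by one function: a constant if the points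
    agree (then so do the signs), an affine function otherwise. *)
Lemma half_meet d1 d2 t1 t2 : d2 <> opp d1 ->
  exists2 i, half f d1 t1 i & half f d2 t2 i.
Proof.
move=> d12.
suff [u cu [u1 u2]] : exists2 u : K -> R, continuous u &
    t1 + 1 <= ev d1 u /\ t2 + 1 <= ev d2 u.
  have [i hi] := f_dense cu (@ltr01 R).
  have H d t : t + 1 <= ev d u -> half f d t i.
    move=> td; rewrite /half /=; have := hi d.1.
    move: td; rewrite /ev -(norm_sg d.2) -sgB ltr_norml => td /andP[h1 h2].
    lra.
  by exists i; exact: H.
case: d1 d2 d12 => x b1 [y b2]; rewrite /opp /= => d12.
have [xy|xy] := eqVneq x y.
  have b12 : b2 = b1 by case: b1 b2 d12 => -[] //; rewrite xy.
  exists (fun=> sg b1 (Num.max t1 t2 + 1)); first exact: continuous_const.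
  by rewrite /ev /= b12 !sgK !lerD2r !le_max !lexx orbT.
have sxy : sval y - sval x != 0.
  by rewrite subr_eq0; apply: contra_neq xy => e; rewrite -[y]svalK e svalK.
pose A := sg b1 (t1 + 1); pose B := sg b2 (t2 + 1).
(* The line with value [A] at [x] and [B] at [y]. *)
exists (fun z => A + (B - A) / (sval y - sval x) * (sval z - sval x)).
  apply: continuous_add; first exact: continuous_const.
  apply/continuous_mulr/continuous_sub; last exact: continuous_const.
  exact: sval_continuous.
rewrite /ev /= subrr mulr0 addr0 divfK // [A + (B - A)]addrC subrK !sgK.
by split.
Qed.

(** Otherwise the first half-space meets one in direction [opp d2] that is disjoint from the
    second. *)
Lemma half_sub d1 d2 t1 t2 : half f d1 t1 `<=` half f d2 t2 -> d1 = d2.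
Proof.
move=> sub; apply: contrapT => d12.
have [|i /sub + ] := @half_meet d1 (opp d2) t1 (- t2).
  by move=> /(congr1 opp); rewrite !oppK => /esym.
by rewrite /half /= ev_opp ltrN2 => /lt_trans /[apply]; rewrite ltxx.
Qed.

Lemma half_proper d t : exists i, ~ half f d t i.
Proof.
have [|i hi _] := @half_meet (opp d) (opp d) (- t) 0; first by case: d => x [].
exists i; move: hi; rewrite /half /= ev_opp ltrN2 => /ltW.
by rewrite leNgt => /negP.
Qed.

Context (E : I -> I -> Prop) (fE : unit_graph E f).

(** Chains are bounded by the triangle inequality. Conversely, in the inductive step, the first edge
    goes to a member of the family near the point that divides the way from [f i] to [f j] in the
    ratio 1 to [q]. *)
Lemma reachP k i j :
  reach E k i j <-> forall x, `|f i x - f j x| < 2 * k.+1%:R.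
Proof.
elim: k i => [|k IH] i /=; first by rewrite mulr1; exact: fE.
split=> [[l [/fE il /IH lj]] x|ij].
  have := ler_distD (f l x) (f i x) (f j x); have := il x; have := lj x.
  by rewrite -(natr1 k.+1) mulrDr mulr1; lra.
have [m hm] : exists m, forall x, `|f i x - f j x| <= `|f i m - f j m|.
  apply: max_unit_interval; apply/continuous_normr/continuous_sub;
  exact: C01_continuous.
have := ij m; set M := `|f i m - f j m| in hm * => Mlt.
set q : R := k.+1%:R in IH *.
have q1 : 1 <= q by rewrite /q ler1n.
pose c : R := (q + 1)^-1.
have qc : c * (q + 1) = 1 by rewrite mulVf //; lra.
have c0 : 0 < c by rewrite invr_gt0; lra.
have M0 : 0 <= M by exact: normr_ge0.
have cM : c * M < 2.
  have : c * M < c * (2 * (q + 1)).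
    by rewrite ltr_pM2l // /q natr1.
  by rewrite mulrCA qc mulr1.
(* The tolerance [2 - c * M] keeps the first edge below 2; the remaining distance is below
   [q * c * M + 2 - c * M], at most [2 * q] since [c * M < 2]. *)
have [||l hl] := @f_dense (fun x => f i x + c * (f j x - f i x)) (2 - c * M).
- apply: continuous_add; first exact: C01_continuous.
  by apply/continuous_mulr/continuous_sub; exact: C01_continuous.
- lra.
have cD x : `|c * (f i x - f j x)| <= c * M.
  by rewrite normrM gtr0_norm // ler_pM2l.
exists l; split; first apply/fE => x.
  have := hl x; have := cD x; rewrite ler_norml !ltr_norml.
  move=> /andP[? ?] /andP[? ?]; apply/andP; split; lra.
apply/IH => x; have := hl x; have := hm x; rewrite ler_norml !ltr_norml.
have qcM : (q - 1) * (c * M) <= (q - 1) * 2 by apply: ler_wpM2l; lra.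
move=> /andP[h1 h2] /andP[h3 h4].
set D := f i x - f j x in h1 h2.
have qcD : `|q * (c * D)| <= q * (c * M).
  by rewrite normrM gtr0_norm; [apply: ler_wpM2l; [lra|exact: cD]|lra].
have cqD : c * D = D - q * (c * D).
  by rewrite -{2}[D]mul1r -qc; ring.
have e1 : c * (f j x - f i x) = - (c * D) by rewrite /D; lra.
move: qcD; rewrite ler_norml => /andP[h5 h6].
rewrite e1 cqD /D in h3 h4; rewrite /D in h5 h6.
by apply/andP; split; lra.
Qed.

Lemma reachxx k i : reach E k i i.
Proof. by apply/reachP => x; rewrite subrr normr0 mulr_gt0. Qed.

(** [w] is the minimum of the signed members of [s] and the constant [t + 1]; it locates a large
    ball around [s] inside the half-space. *)
Lemma envelope (s : seq I) d t : (forall i, i \in s -> half f d t i) ->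
  exists (w : K -> R) (M : R), [/\ continuous w, t < w d.1 &
    forall i, i \in s -> forall x, w x <= sg d.2 (f i x) <= w x + M].
Proof.
elim: s => [_|a s IH hs].
  exists (fun=> t + 1), 0; split=> //; first exact: continuous_const.
  by rewrite ltrDl.
have [|w [M [cw wd hw]]] := IH.
  by move=> i si; apply: hs; rewrite inE si orbT.
have cfa : continuous (fun x => sg d.2 (f a x)).
  exact/continuous_sg/C01_continuous.
have [m hm] := max_unit_interval (continuous_normr (continuous_sub cw cfa)).
set N := `|_| in hm.
exists (fun x => Num.min (w x) (sg d.2 (f a x))), (`|M| + N); split.
- exact: continuous_minr.
- by rewrite lt_min wd; apply: hs; rewrite mem_head.
move=> i; rewrite inE => /predU1P[->|si] x; have := hm x; rewrite ler_norml.
  by have := normr_ge0 M; rewrite minEle; case: ifP => ? ? /andP[? ?];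
    apply/andP; split; lra.
have := hw i si x; have := ler_norm M.
by rewrite minEle; case: ifP => ? ? /andP[? ?] /andP[? ?];
  apply/andP; split; lra.
Qed.

Lemma half_horoball d t : horoball E (half f d t).
Proof.
move=> s /envelope[w [M [cw wd hw]]].
set x0 := d.1 in wd.
pose dl := w x0 - t.
have dl0 : 0 < dl by rewrite subr_gt0.
have [k Mk] : exists k : nat, M + dl < k.+1%:R.
  exists (Num.truncn `|M + dl|).
  by apply: le_lt_trans (ler_norm _) _; exact: truncnS_gt.
set r : R := 2 * k.+1%:R.
have r2 : 2 * (M + dl) < r by rewrite /r ltr_pM2l.
have r0 : 0 < r by rewrite mulr_gt0.
(* Up to [dl / 4], the ball of radius [r] around this centre has its lower boundary at [w - dl / 2]:
   below all of [s], yet above [t = w x0 - dl] at [x0]. *)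
have [||a ha] := @f_dense (fun x => sg d.2 (w x + (r - dl / 2))) (dl / 4).
- apply/continuous_sg/continuous_add => //; exact: continuous_const.
- lra.
have {}ha x : `|sg d.2 (f a x) - (w x + (r - dl / 2))| < dl / 4.
  by rewrite -[w x + _](sgK d.2) sgB norm_sg.
exists a, k; split=> i.
  move=> /hw hi; apply/reachP => x; rewrite -(norm_sg d.2) -sgB -/r.
  move: (hi x) (ha x) => /andP[h1 h2]; rewrite !ltr_norml => /andP[h3 h4].
  by apply/andP; split; lra.
move=> /reachP/(_ x0); rewrite -(norm_sg d.2) -sgB -/r /half /= /ev -/x0.
move: (ha x0); rewrite /dl !ltr_norml => /andP[h3 h4] /andP[h5 h6]; lra.
Qed.

Lemma horoball_no_min H d i : horoball E H -> H i ->
  exists2 j, H j & ev d (f j) < ev d (f i).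
Proof.
move=> hH Hi; have [|a [k [/(_ i (mem_head _ _))/reachP ai aH]]] := hH [:: i].
  by move=> j; rewrite inE => /eqP ->.
have [m hm] : exists m, forall x, `|f a x - f i x| <= `|f a m - f i m|.
  apply: max_unit_interval; apply/continuous_normr/continuous_sub;
  exact: C01_continuous.
have := ai m; set M := `|f a m - f i m| in hm * => Mlt.
set r : R := 2 * _ in Mlt ai.
(* The ball leaves room [r - M] around [f i]. Half of it is spent on the shift and half on the
   error, so [j] stays in the ball and is strictly lower. *)
have [||j hj] := @f_dense (fun x => f i x - sg d.2 ((r - M) / 2)) ((r - M) / 2).
- apply: continuous_sub; [exact: C01_continuous|exact: continuous_const].
- lra.
have {}hj x : `|sg d.2 (f j x) - (sg d.2 (f i x) - (r - M) / 2)| < (r - M) / 2.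
  by rewrite -{1}[(r - M) / 2](sgK d.2) !sgB norm_sg.
exists j; last by move: (hj d.1); rewrite /ev ltr_norml => /andP[? ?]; lra.
apply/aH/reachP => x; rewrite -(norm_sg d.2) -sgB.
move: (hj x) (hm x); rewrite -(norm_sg d.2 (f a x - _)) -sgB.
rewrite ler_norml !ltr_norml -/r => /andP[? ?] /andP[? ?].
by apply/andP; split; lra.
Qed.

(** By compactness finitely many members of [H] suffice to have, at each point, one below and one
    above [f i]. A ball in [H] containing them all contains [i], whose values are squeezed between
    theirs. *)
Lemma horoball_fill H i : horoball E H ->
  (forall d, exists2 j, H j & ev d (f j) < ev d (f i)) -> H i.
Proof.
move=> hH Hd.
have cov b : exists s : seq I, (forall j, j \in s -> H j) /\
    (forall x, exists2 j, j \in s & sg b (f j x) < sg b (f i x)).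
  apply: (@unit_interval_cover R I H
    (fun j => [set x | sg b (f j x) < sg b (f i x)])) => [j _|x].
    rewrite (_ : [set _ | _] =
      (fun x => sg b (f i x) - sg b (f j x)) @^-1` [set r | 0 < r]).
      apply: open_comp; last exact: open_gt.
      move=> x _; apply: continuous_sub => //;
      exact/continuous_sg/C01_continuous.
    by apply/seteqP; split=> x /=; rewrite subr_gt0.
  by have [j Hj ji] := Hd (x, b); exists j.
have [s1 [s1H s1i]] := cov true; have [s2 [s2H s2i]] := cov false.
have [|a [k [sa aH]]] := hH (s1 ++ s2).
  by move=> j; rewrite mem_cat => /orP[/s1H|/s2H].
apply/aH/reachP => x.
have [j1 j1s /= h1] := s1i x; have [j2 j2s /= h2] := s2i x.
have /sa/reachP/(_ x) : j1 \in s1 ++ s2 by rewrite mem_cat j1s.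
have /sa/reachP/(_ x) : j2 \in s1 ++ s2 by rewrite mem_cat j2s orbT.
rewrite !ltr_norml => /andP[? ?] /andP[? ?]; apply/andP; split; lra.
Qed.

Lemma horoball_proper_sub_half H : horoball E H -> (exists i, ~ H i) ->
  exists d t, H `<=` half f d t.
Proof.
move=> hH [i nHi]; apply: contrapT => nb; apply: nHi.
apply: horoball_fill => // d; apply: contrapT => nj; apply: nb.
(* Subtracting 1 turns the weak bound by [ev d (f i)] into a strict one. *)
exists d, (ev d (f i) - 1) => j Hj; rewrite /half /=.
have [ji|?] := ltP (ev d (f j)) (ev d (f i)); last lra.
by case: nj; exists j.
Qed.

(** The level is the infimum of [ev d] over [H], not attained by [horoball_no_min]. If
    [horoball_fill] failed in another direction, [H] would lie in a half-space of that direction,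
    against uniqueness. *)
Lemma horoball_eq_half H d t : horoball E H -> H `<=` half f d t ->
  (forall d' t', H `<=` half f d' t' -> d' = d) -> exists t', H = half f d t'.
Proof.
move=> hH Hd uniq.
pose V := [set ev d (f i) | i in H].
have V0 : V !=set0.
  have [|a [k [_ aH]]] := hH [::]; first by [].
  by exists (ev d (f a)), a => //; exact/aH/reachxx.
have Vinf : has_inf V.
  by split=> //; exists t => _ [i /Hd + <-]; rewrite /half /= => /ltW.
exists (inf V); apply/seteqP; split=> i.
  move=> Hi; have [j Hj] := horoball_no_min d hH Hi; rewrite /half /=.
  by apply: le_lt_trans; apply: inf_lbound; [case: Vinf|exists j].
rewrite /half /= => Vi; apply: horoball_fill => // d'.
have [->|dd] := pselect (d' = d).
  have iV : 0 < ev d (f i) - inf V by rewrite subr_gt0.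
  have [_ [j Hj <-] ji] := inf_adherent iV Vinf.
  by exists j => //; rewrite addrC subrK in ji.
apply: contrapT => nj; apply: dd; apply: (uniq _ (ev d' (f i) - 1)) => j Hj.
rewrite /half /=; have [ji|?] := ltP (ev d' (f j)) (ev d' (f i)); last lra.
by case: nj; exists j.
Qed.

(** Every proper horoball above a half-space is a half-space of the same direction, and these are
    nested by level. *)
Lemma half_halfspace_like d t : halfspace_like E (half f d t).
Proof.
have sup H : horoball E H -> (exists i, ~ H i) -> half f d t `<=` H ->
    exists t', H = half f d t'.
  move=> hH pH dH; have [d' [t' Hd]] := horoball_proper_sub_half hH pH.
  have dd := half_sub (subset_trans dH Hd); rewrite -dd in Hd.
  apply: horoball_eq_half hH Hd _ => d2 t2 Hd2.
  by apply/esym/half_sub; exact: subset_trans dH Hd2.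
split; [exact: half_horoball|exact: half_proper|].
move=> H1 H2 h1 p1 h2 p2 /(sup _ h1 p1)[t1 ->] /(sup _ h2 p2)[t2 ->].
have [t12|/ltW t21] := leP t1 t2; [right|left] => i; exact: le_lt_trans.
Qed.

(** Half-spaces containing [H] are comparable by the chain condition, hence share one direction. *)
Lemma halfspace_like_half H : halfspace_like E H -> exists d t, H = half f d t.
Proof.
move=> [hH pH chain]; have [d [t Hd]] := horoball_proper_sub_half hH pH.
exists d; apply: (horoball_eq_half hH Hd) => d' t' Hd'.
have [|/half_sub //] := chain _ _ (@half_horoball d t) (half_proper d t)
  (@half_horoball d' t') (half_proper d' t') Hd Hd'.
by move=> /half_sub.
Qed.

End horoballs.

(** * From a common unit graph to a homeomorphism *)

Section transfer.
Context (R : realType) (I : choiceType) (E : I -> I -> Prop).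
Local Notation K := (unit_interval R).
Implicit Types (f g : I -> C01 R) (d : K * bool).

(** Half-spaces of both families are subsets of the same [I], so they can be equal; the direction
    [F d] must not depend on the level. *)
Definition direction_map f g (F : K * bool -> K * bool) :=
  forall d t, exists t', half f d t = half g (F d) t'.

Lemma direction_map_exists f g :
  dense_family f -> unit_graph E f -> dense_family g -> unit_graph E g ->
  exists F, direction_map f g F.
Proof.
move=> fd fE gd gE.
have ex d t : exists d' t', half f d t = half g d' t'.
  exact/(halfspace_like_half gd gE)/half_halfspace_like.
(* [F] is read off at level 0. Other levels give nested half-spaces, so [half_sub] yields the same
   direction. *)
have [F HF] := choice (fun d => ex d 0).
exists F => d t; have [d' [t' dd']] := ex d t; have [t0 d0] := HF d.
suff -> : F d = d' by exists t'.
have [t1|/ltW t1] := leP t 0.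
  by apply: (half_sub gd (t1 := t0) (t2 := t')); rewrite -dd' -d0 => i;
    exact: le_lt_trans.
by apply/esym/(half_sub gd (t1 := t') (t2 := t0)); rewrite -dd' -d0 => i;
  exact: le_lt_trans.
Qed.

Lemma direction_mapK f g F F' : dense_family f ->
  direction_map f g F -> direction_map g f F' -> cancel F F'.
Proof.
move=> fd HF HF' d; have [t' e] := HF d 0; have [t2 e2] := HF' (F d) t'.
by apply/esym/(half_sub fd (t1 := 0) (t2 := t2)); rewrite e e2.
Qed.

(** Opposite half-spaces at level 0 are disjoint, and by [half_meet] only opposite directions admit
    disjoint half-spaces. *)
Lemma direction_map_opp f g F : dense_family g ->
  direction_map f g F -> forall d, F (opp d) = opp (F d).
Proof.
move=> gd HF d; apply: contrapT => neq.
have [t1 e1] := HF d 0; have [t2 e2] := HF (opp d) 0.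
have [i] := half_meet gd t1 t2 neq; rewrite -e1 -e2 /half /= ev_opp oppr_gt0.
by move=> /lt_trans /[apply]; rewrite ltxx.
Qed.

(** The half-space at level [ev d (f j)] contains [i] but not [j], and so does its counterpart for
    [g]. *)
Lemma direction_map_lt f g F d i j : direction_map f g F ->
  ev d (f j) < ev d (f i) -> ev (F d) (g j) < ev (F d) (g i).
Proof.
move=> HF ji; have [t e] := HF d (ev d (f j)).
have : half g (F d) t i by rewrite -e.
apply: le_lt_trans; rewrite leNgt; apply/negP => jt.
by have : half g (F d) t j by []; rewrite -e /half /= ltxx.
Qed.

Definition point_map (F : K * bool -> K * bool) (x : K) : K := (F (x, true)).1.

Lemma direction_map_sign f g F F' :
  dense_family f -> direction_map f g F -> cancel F' F ->
  (forall d, F (opp d) = opp (F d)) ->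
  exists b, forall x, F (x, true) = (point_map F x, b).
Proof.
move=> fd HF F'K Fo.
(* With [f i] near 1 and [f j] near 0, [f j < f i] everywhere. As [point_map F] is onto, [g i - g j]
   never vanishes, and its constant sign is [b]. *)
have [i hi] := fd _ (1/4) (@continuous_const R 1) ltac:(lra).
have [j hj] := fd _ (1/4) (@continuous_const R 0) ltac:(lra).
have ji x : f j x < f i x.
  by move: (hi x) (hj x); rewrite !ltr_norml => /andP[? ?] /andP[? ?]; lra.
have gji x : ev (F (x, true)) (g j) < ev (F (x, true)) (g i).
  by apply: direction_map_lt HF _; exact: ji.
have Fsurj y : exists x, point_map F x = y.
  rewrite /point_map; case e : (F' (y, true)) => [x []]; exists x.
    by rewrite -e F'K.
  by rewrite -[(x, true)]/(opp (x, false)) -e Fo F'K.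
have cg : continuous (fun y => g i y - g j y).
  by apply: continuous_sub; exact: C01_continuous.
have g0 y : g i y - g j y != 0.
  have [x <-] := Fsurj y; rewrite /point_map; move: (gji x).
  by rewrite subr_eq0; case: (F _) => z [] /=; rewrite /ev /= ?ltrN2 => ?;
    [rewrite gt_eqF|rewrite lt_eqF].
have same := nonvanishing_same_sign cg g0.
exists (0 < g i (clamp 0) - g j (clamp 0)) => x.
rewrite (same _ (point_map F x)) /point_map; move: (gji x).
case: (F _) => z [] /=; rewrite /ev /= => h; congr pair.
  by rewrite subr_gt0 h.
by apply/esym/negbTE; rewrite -leNgt; lra.
Qed.

Lemma point_map_continuous f g F F' b : dense_family g ->
  direction_map f g F -> direction_map g f F' -> cancel F F' ->
  (forall x, F (x, true) = (point_map F x, b)) ->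
  continuous (point_map F).
Proof.
move=> gd HF HF' FK Fb x N /nbhs_sval[e e0 eN].
set y0 := point_map F x in eN.
have e4 : 0 < e / 8 by lra.
(* With errors below [e / 8], the signed [g i] exceeds the signed [g j] at [y0], and only at points
   within [3 * e / 4] of [y0]. *)
pose bump (y : K) := sg b (e / 2 - `|sval y - sval y0|).
have cb : continuous bump.
  apply/continuous_sg/continuous_sub; first exact: continuous_const.
  apply/continuous_normr/continuous_sub; last exact: continuous_const.
  exact: sval_continuous.
have [i hi] := gd _ _ cb e4.
have [j hj] := gd _ _ (@continuous_const R 0) e4.
have {}hi y : `|sg b (g i y) - (e / 2 - `|sval y - sval y0|)| < e / 8.
  by rewrite -[e / 2 - _](sgK b) sgB norm_sg.
have {}hj y : `|sg b (g j y)| < e / 8.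
  by rewrite norm_sg -[g j y]subr0.
have : f j x < f i x.
  have := @direction_map_lt g f F' (y0, b) i j HF'.
  rewrite /y0 -Fb FK /ev /= Fb; apply => /=; rewrite -/y0.
  move: (hi y0) (hj y0); rewrite subrr normr0 !ltr_norml.
  by move=> /andP[? ?] /andP[? ?]; lra.
rewrite -subr_gt0 => fij.
have cf : continuous (fun z => f i z - f j z).
  by apply: continuous_sub; exact: C01_continuous.
have : nbhs x [set z | 0 < f i z - f j z].
  by apply: (cf x [set r | 0 < r]); exact: lt_nbhsr.
rewrite nbhs_simpl; apply: filterS => z /=; rewrite subr_gt0 => fz.
apply: eN; have := @direction_map_lt f g F (z, true) i j HF.
rewrite /ev Fb /= => /(_ fz) ?.
have := hi (point_map F z); rewrite ltr_norml => /andP[? ?].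
by have := hj (point_map F z); rewrite ltr_norml => /andP[? ?]; lra.
Qed.

Lemma same_unit_graph_homeomorphism f g :
  dense_family f -> unit_graph E f -> dense_family g -> unit_graph E g ->
  exists (psi : K -> K) (b : bool), homeomorphism psi /\
    forall i j x, f j x < f i x -> sg b (g j (psi x)) < sg b (g i (psi x)).
Proof.
move=> fd fE gd gE.
have [F HF] := direction_map_exists fd fE gd gE.
have [F' HF'] := direction_map_exists gd gE fd fE.
have FK := direction_mapK fd HF HF'; have F'K := direction_mapK gd HF' HF.
have Fo := direction_map_opp gd HF; have F'o := direction_map_opp fd HF'.
have [b Fb] := direction_map_sign fd HF F'K Fo.
have [b' F'b] := direction_map_sign gd HF' FK F'o.
exists (point_map F), b; split=> [|i j x ji]; last first.
  by have := @direction_map_lt f g F (x, true) i j HF ji; rewrite /ev Fb.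
have pK (F1 F2 : K * bool -> K * bool) b1 : cancel F1 F2 ->
    (forall d, F2 (opp d) = opp (F2 d)) ->
    (forall x, F1 (x, true) = (point_map F1 x, b1)) ->
    cancel (point_map F1) (point_map F2).
  move=> F12 Fo2 Fb1 x; have := F12 (x, true); rewrite Fb1.
  set y := point_map F1 x; rewrite /point_map.
  case: b1 {Fb1} => [->//|e].
  by rewrite -[(y, true)]/(opp (y, false)) Fo2 e.
split; first exact: (point_map_continuous gd HF HF' FK Fb).
exists (point_map F'); split.
  exact: (point_map_continuous fd HF' HF F'K F'b).
  exact: pK Fb.
exact: pK F'b.
Qed.

End transfer.

(** * Infinitely many independent events *)

Section none_occurs.
Context (d : measure_display) (T : measurableType d) (R : realType).
Context (P : probability T R) (I : choiceType) (A : I -> set T) (q : R).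
Context (D : pred I) (mA : forall i, D i -> measurable (A i)).

Lemma measurable_bigsetI (F : I -> set T) (s : seq I) :
  (forall i, i \in s -> measurable (F i)) ->
  measurable (\big[setI/setT]_(i <- s) F i).
Proof. by move=> mF; rewrite big_seq; exact: bigsetI_measurable. Qed.

Context (PA : forall s : seq I, uniq s -> all D s ->
  P (\big[setI/setT]_(i <- s) A i) = (q ^+ size s)%:E).

(** Complements are introduced one at a time: the case of [i :: s] and [t] is the difference of the
    cases [s], [t] and [s], [i :: t]. *)
Lemma probability_some_none (s t : seq I) : uniq (s ++ t) -> all D (s ++ t) ->
  P (\big[setI/setT]_(i <- s) (~` A i) `&` \big[setI/setT]_(i <- t) A i) =
  ((1 - q) ^+ size s * q ^+ size t)%:E.
Proof.
elim: s t => [|i s IH] t.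
  by move=> ut Dt; rewrite big_nil setTI mul1r; exact: PA.
move=> uist Dist; have pst : perm_eq ((i :: s) ++ t) (s ++ i :: t).
  by rewrite -cat1s -catA perm_catCA.
have := IH (i :: t); rewrite -(perm_uniq pst) -(perm_all _ pst).
move=> /(_ uist Dist); move: (uist) (Dist) => /= /andP[_ ust] /andP[Di Dst].
have := IH t ust Dst; move: Dst; rewrite all_cat => /andP[/allP Ds /allP Dt].
rewrite !big_cons.
set X := \big[setI/setT]_(j <- s) _; set Y := \big[setI/setT]_(j <- t) _.
move=> PXY PAXY.
have mXY : measurable (X `&` Y).
  apply: measurableI; apply: measurable_bigsetI => j.
    by move=> /Ds /mA; exact: measurableC.
  by move=> /Dt /mA.
have -> : ~` A i `&` X `&` Y = (X `&` Y) `\` A i.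
  by rewrite -setIA setIC setDE.
rewrite measureD //; [|exact: mA|by rewrite [ltLHS]PXY ltry].
rewrite -setIA [Y `&` _]setIC [X in (X - _)%E]PXY [X in (_ - X)%E]PAXY.
by rewrite -EFinB; congr EFin; rewrite !exprS; ring.
Qed.

Lemma probability_none (s : seq I) : uniq s -> all D s ->
  P (\big[setI/setT]_(i <- s) (~` A i)) = ((1 - q) ^+ size s)%:E.
Proof.
move=> us Ds; have := @probability_some_none s [::].
by rewrite cats0 big_nil setIT mulr1; exact.
Qed.

Lemma negligible_none : 0 < q <= 1 ->
  (forall n : nat, exists s : seq I, [/\ size s = n, uniq s & all D s]) ->
  P.-negligible [set w | forall i, ~ A i w].
Proof.
move=> /andP[q0 q1] /choice[s hs].
pose B n := \big[setI/setT]_(i <- s n) (~` A i).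
have mB n : measurable (B n).
  have [_ _ /allP Ds] := hs n.
  by apply: measurable_bigsetI => i /Ds /mA; exact: measurableC.
have PB n : P (B n) = ((1 - q) ^+ n)%:E.
  by have [sn un Dn] := hs n; rewrite probability_none // sn.
(* [I] may be uncountable, so the set is covered by a countable intersection, of measure at most
   [(1 - q) ^+ n] for all [n]. *)
exists (\bigcap_n B n); split.
- exact: bigcapT_measurable.
- have mI : measurable (\bigcap_n B n) by exact: bigcapT_measurable.
  have le n : (P (\bigcap_n B n) <= ((1 - q) ^+ n)%:E)%E.
    by rewrite -PB; apply: le_measure; rewrite ?inE //; exact: bigcap_inf.
  have fP : P (\bigcap_n B n) \is a fin_num by exact: fin_num_measure.
  rewrite -(fineK fP); congr EFin; apply/eqP; rewrite eq_le.
  rewrite fine_ge0 ?measure_ge0 // andbT.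
  have := @cvg_expr R (1 - q); rewrite ger0_norm ?subr_ge0 // => /(_ _) cq.
  have {}cq : (1 - q) ^+ n @[n --> \oo] --> 0 by apply: cq; lra.
  apply: (@cvgr_to_ge _ _ _ _ _ _ _ cq).
  by apply: nearW => n; rewrite -lee_fin fineK.
- move=> w nA n _; rewrite /B -bigcap_seq => i _ /=; exact: nA.
Qed.

End none_occurs.

(** * Common neighbours in the random graph *)

Definition two_paths (X : Type) (u v : X) (s : seq X) : seq (X * X) :=
  flatten [seq [:: (u, z); (z, v)] | z <- s].

Lemma size_two_paths (X : Type) (u v : X) (s : seq X) :
  size (two_paths u v s) = (2 * size s)%N.
Proof. by elim: s => //= z s ->; rewrite mulnS. Qed.

(** Supplies [distinct_pairs] for the independence clause of [is_LARG]. *)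
Lemma two_paths_distinct (X : eqType) (u v : X) (s : seq X) : u != v ->
  uniq [:: u, v & s] ->
  pairwise (fun e e' => (e != e') && (e != (e'.2, e'.1))) (two_paths u v s).
Proof.
move=> uv; elim: s => [//|z s IH] /= /and4P[].
rewrite !inE !negb_or => /and3P[_ uz us] /andP[vz vs] zs uqs.
rewrite IH ?andbT; last by rewrite /= inE negb_or uv us vs uqs.
rewrite !xpair_eqE (negPf uv) (negPf uz) /=.
apply/andP; split; apply/allP => e /flatten_mapP[y ys].
  have [uy vy] : u != y /\ v != y.
    by split; [move: us|move: vs]; apply: contraNneq => ->.
  have zy : z != y by move: zs; apply: contraNneq => ->.
  rewrite !inE => /orP[]/eqP -> /=; rewrite !xpair_eqE.
    by rewrite (negPf uy) (negPf zy) andbF.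
  by rewrite (negPf uy) (negPf uv).
have zy : z != y by move: zs; apply: contraNneq => ->.
have zu : z != u by rewrite eq_sym.
have zv : z != v by rewrite eq_sym.
rewrite !inE => /orP[]/eqP -> /=; rewrite !xpair_eqE.
  by rewrite (negPf zy) (negPf zu).
by rewrite (negPf zy) (negPf zv).
Qed.

Section larg.
Context (R : realType) (d : measure_display) (T : measurableType d).
Context (P : probability T R) (V : set (C01 R)) (p : R).
Context (G : T -> rel (C01 R)) (G_larg : is_LARG P V p G) (hp : 0 < p < 1).

Lemma larg_common_neighbour (u v : C01 R) : u != v ->
  (forall n : nat, exists s : seq (C01 R), [/\ size s = n, uniq s &
    forall z, z \in s -> larg_pair V (u, z) /\ larg_pair V (z, v)]) ->
  P.-negligible [set w | ~ exists z, G w u z /\ G w z v].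
Proof.
move=> uv many; have [_ _ mG PG indep] := G_larg.
pose A z := edge_event G (u, z) `&` edge_event G (z, v).
pose D z := `[< larg_pair V (u, z) /\ larg_pair V (z, v) >].
have : P.-negligible [set w | forall z, ~ A z w].
  apply: (@negligible_none _ _ _ _ _ A (p ^+ 2) D).
  - by move=> z /asboolP[uz zv]; apply: measurableI; exact: mG.
  - move=> s us /allP Ds.
    have Dsz z : z \in s -> larg_pair V (u, z) /\ larg_pair V (z, v).
      by move=> /Ds /asboolP.
    have pairs e : e \in two_paths u v s -> larg_pair V e.
      move=> /flatten_mapP[z /Dsz[uz zv]].
      by rewrite !inE => /orP[]/eqP ->.
    have nu : u \notin s.
      by apply/negP => /Dsz[[_ _ /=]]; rewrite eqxx.
    have nv : v \notin s.
      by apply/negP => /Dsz[_ [_ _ /=]]; rewrite eqxx.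
    have ud : uniq [:: u, v & s].
      by rewrite !cons_uniq inE negb_or uv nu nv us.
    have := indep (two_paths u v s) pairs (two_paths_distinct uv ud).
    rewrite bigcap_seq.
    rewrite (_ : \prod_(e <- _) _ = ((p ^+ 2) ^+ size s)%:E)%E; last first.
      rewrite big_seq (eq_bigr (fun=> p%:E)); last by move=> e /pairs /PG.
      rewrite -big_seq prodEFin; congr EFin; rewrite -exprM.
      by rewrite big_const_seq count_predT size_two_paths iter_mulr_1.
    rewrite /two_paths big_flatten big_map => <-; congr (P _).
    apply: eq_bigr => z _; rewrite !big_cons big_nil.
    by rewrite /= setIT.
  - by move: hp => /andP[p0 p1]; rewrite exprn_gt0 // exprn_ile1 // ltW.
  - move=> n; have [s [sn us Ds]] := many n; exists s; split=> //.
    by apply/allP => z /Ds ?; apply/asboolP.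
apply: negligibleS => w /= nz z [uz zv]; apply: nz; exists z; split.
  exact: uz.
exact: zv.
Qed.

End larg.

(** * Recovering distance less than 2 from the random graph *)

Section dense_sequence.
Context (R : realType) (f : nat -> C01 R).
Local Notation K := (unit_interval R).

Lemma C01_dense_family : C01_dense (range f) -> dense_family f.
Proof.
move=> fd u e cu e0.
have [_ [i _ <-] /C01_dist_lt hi] := fd (mkcts cu : continuousType _ _) e e0.
by exists i.
Qed.

Context (f_dense : dense_family f).

(** An index [a] is excluded by looking at the point 0: if [f a] agrees with [m] there, the target
    is raised by [e / 2]; otherwise the tolerance is cut to the gap. *)
Lemma dense_family_avoid (s : seq nat) (m : K -> R) (e : R) :
  continuous m -> 0 < e -> exists2 k, k \notin s & forall x, `|f k x - m x| < e.
Proof.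
elim: s m e => [|a s IH] m e cm e0.
  by have [k hk] := f_dense cm e0; exists k.
pose o : K := clamp 0.
have [fa|fa] := eqVneq (f a o) (m o).
  have [||k ks hk] := IH (fun x => m x + e / 2) (e / 2).
  - by apply: continuous_add => //; exact: continuous_const.
  - lra.
  exists k => [|x].
    rewrite inE negb_or ks andbT; apply/eqP => ka.
    have := hk o; rewrite ka fa ltr_norml => /andP[? ?]; lra.
  by have := hk x; rewrite !ltr_norml => /andP[? ?]; apply/andP; split; lra.
have fa0 : 0 < `|f a o - m o| by rewrite normr_gt0 subr_eq0.
have [||k ks hk] := IH m (Num.min e `|f a o - m o|) => //.
  by rewrite lt_min e0 fa0.
exists k => [|x]; last by have := hk x; rewrite lt_min => /andP[].
rewrite inE negb_or ks andbT; apply/eqP => ka.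
by have := hk o; rewrite ka lt_min ltxx andbF.
Qed.

Context (f_inj : injective f).

Lemma many_common_candidates i j : i <> j -> C01_dist (f i) (f j) < 2 ->
  forall n : nat, exists s : seq (C01 R), [/\ size s = n, uniq s &
    forall z, z \in s -> larg_pair (range f) (f i, z) /\
                         larg_pair (range f) (z, f j)].
Proof.
move=> ij /C01_dist_lt dij n.
have [m hm] : exists m, forall x, `|f i x - f j x| <= `|f i m - f j m|.
  apply: max_unit_interval; apply/continuous_normr/continuous_sub;
  exact: C01_continuous.
have := dij m; set M := `|f i m - f j m| in hm * => M2.
pose mid x := (1/2) * (f i x + f j x).
have cmid : continuous mid.
  by apply/continuous_mulr/continuous_add; exact: C01_continuous.
(* The midpoint is within [M / 2] of both ends, so this tolerance keeps candidates at distance below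
   1 from each. *)
have e0 : 0 < 1 - M / 2 by lra.
have [s [sn us close]] : exists s : seq nat, [/\ size s = n,
    uniq [:: i, j & s] &
    forall k, k \in s -> forall x, `|f k x - mid x| < 1 - M / 2].
  elim: n => [|n [s [sn us close]]].
    by exists [::]; split=> //=; rewrite inE andbT; apply/eqP.
  have [k ks hk] := dense_family_avoid [:: i, j & s] cmid e0.
  exists (k :: s); split=> [||l]; first by rewrite /= sn.
  - move: ks us; rewrite /= !inE !negb_or => /and3P[ki kj ->].
    by rewrite [i == k]eq_sym [j == k]eq_sym ki kj.
  - by rewrite inE => /predU1P[->|/close].
have in_range k : (range f) (f k) by exists k.
exists [seq f k | k <- s]; split; first by rewrite size_map.
  by rewrite map_inj_uniq //; move: us => /= /and3P[].
move=> _ /mapP[k ks ->]; have ck := close k ks.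
have [ki kj] : i != k /\ k != j.
  move: us => /= /and3P[]; rewrite inE negb_or => /andP[_ is_] js _.
  by split; [move: is_; apply: contraNneq => ->|
             move: js; apply: contraNneq => <-].
have pair a b : a != b -> (forall x, `|f a x - f b x| < 1) ->
    larg_pair (range f) (f a, f b).
  move=> ab dab; split; [exact: in_range|exact: in_range| |exact/C01_dist_lt].
  by apply: contra_neq ab; exact: f_inj.
split; apply: pair => // x; move: (ck x) (hm x); rewrite /mid ler_norml;
  by rewrite !ltr_norml => /andP[? ?] /andP[? ?]; apply/andP; split; lra.
Qed.

(** The null sets of the countably many pairs are united into one; the converse is the triangle
    inequality, edges being shorter than 1. *)
Lemma larg_dist_lt2 (d : measure_display) (T : measurableType d)
    (P : probability T R) (p : R) (G : T -> rel (C01 R)) :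
  is_LARG P (range f) p G -> 0 < p < 1 ->
  P.-negligible [set w | ~ forall i j, i <> j ->
    (C01_dist (f i) (f j) < 2 <->
     exists k, G w (f i) (f k) /\ G w (f k) (f j))].
Proof.
move=> GL hp.
pose B i j := [set w | [/\ i <> j, C01_dist (f i) (f j) < 2 &
  ~ exists z, G w (f i) z /\ G w z (f j)]].
have nB i j : P.-negligible (B i j).
  have [[ij dij]|n] := pselect (i <> j /\ C01_dist (f i) (f j) < 2); last first.
    apply: negligibleS (negligible_set0 P) => w [ij dij _].
    by case: n.
  have uv : f i != f j by apply/eqP => /f_inj.
  have := larg_common_neighbour GL hp uv (many_common_candidates ij dij).
  by apply: negligibleS => w [].
apply: negligibleS (negligible_bigcup (fun i => negligible_bigcup (nB i))).
move=> w /= ng; apply: contrapT => nb; apply: ng => i j ij.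
have [_ GV _ _ _] := GL; split=> [dij|[k [ik kj]]].
  apply: contrapT => nk; apply: nb; exists i => //; exists j => //; split=> //.
  move=> [z [iz zj]]; have [_ [k _ fk] _ _] := GV _ _ _ iz.
  by apply: nk; exists k; rewrite [f k]fk.
have [_ _ _ /C01_dist_lt /= d1] := GV _ _ _ ik.
have [_ _ _ /C01_dist_lt /= d2] := GV _ _ _ kj.
apply/C01_dist_lt => x; apply: le_lt_trans (ler_distD (f k x) _ _) _.
by have := d1 x; have := d2 x; lra.
Qed.

End dense_sequence.

(** * Choice of one good sample and conclusion *)

Lemma product_ae_exists (R : realType) (d1 d2 : measure_display)
    (T1 : measurableType d1) (T2 : measurableType d2)
    (P1 : probability T1 R) (P2 : probability T2 R)
    (A1 : set T1) (A2 : set T2) (A : set (T1 * T2)) :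
  P1.-negligible (~` A1) -> P2.-negligible (~` A2) ->
  (P1 \x P2)%E.-negligible (~` A) ->
  exists w : T1 * T2, [/\ A1 w.1, A2 w.2 & A w].
Proof.
move=> [M1 [mM1 M10 sub1]] [M2 [mM2 M20 sub2]] nA.
have n1 : (P1 \x P2)%E.-negligible (M1 `*` setT).
  exists (M1 `*` setT); split=> //; first exact: measurableX.
  by rewrite product_measure1E // [X in (X * _)%E]M10 mul0e.
have n2 : (P1 \x P2)%E.-negligible (setT `*` M2).
  exists (setT `*` M2); split=> //; first exact: measurableX.
  by rewrite product_measure1E // [X in (_ * X)%E]M20 mule0.
have nU := negligibleU (negligibleU n1 n2) nA.
apply: contrapT => no.
(* Without a common point, three null sets would cover a space of measure 1. *)
have : (P1 \x P2)%E.-negligible (setT `*` setT).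
  apply: negligibleS nU => w _; apply: contrapT => nw; apply: no; exists w.
  split.
  - by apply: contrapT => /sub1 ?; apply: nw; left; left.
  - by apply: contrapT => /sub2 ?; apply: nw; left; right.
  - by apply: contrapT => ?; apply: nw; right.
move=> nT; have : (P1 \x P2)%E (setT `*` setT) = 0%E.
  by apply: measure_negligible nT; exact: measurableX.
rewrite product_measure1E // [X in (X * _)%E]probability_setT.
by rewrite [X in (_ * X)%E]probability_setT mule1 => /eqP; rewrite eqe oner_eq0.
Qed.

Theorem theorem18 (R : realType) (f g : nat -> C01 R) (p p' : R)
    (f_inj : injective f) (g_inj : injective g)
    (f_dense : C01_dense (range f)) (g_dense : C01_dense (range g))
    (hp : 0 < p < 1) (hp' : 0 < p' < 1)
    (d1 d2 : measure_display)
    (T1 : measurableType d1) (T2 : measurableType d2)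
    (P1 : probability T1 R) (P2 : probability T2 R)
    (G : T1 -> rel (C01 R)) (H : T2 -> rel (C01 R))
    (G_larg : is_LARG P1 (range f) p G)
    (H_larg : is_LARG P2 (range g) p' H)
    (GH_iso : as_isomorphic P1 P2 (range f) G (range g) H) :
  exists (psi : unit_interval R -> unit_interval R) (n : nat -> nat),
    [/\ homeomorphism psi, bijective n &
        (forall (i j : nat) (x : unit_interval R),
           f i x > f j x -> g (n i) (psi x) >= g (n j) (psi x)) \/
        (forall (i j : nat) (x : unit_interval R),
           f i x > f j x -> g (n i) (psi x) <= g (n j) (psi x))].
Proof.
have fd := C01_dense_family f_dense; have gd := C01_dense_family g_dense.
have [[w1 w2] /= [Gw Hw [phi [[phi_fun phi_inj phi_surj] iso]]]] :=
  product_ae_exists (larg_dist_lt2 fd f_inj G_larg hp)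
    (larg_dist_lt2 gd g_inj H_larg hp') GH_iso.
have in_range (h : nat -> C01 R) i : (range h) (h i) by exists i.
have /choice[n hn] i : exists k, g k = phi (f i).
  by have [k _] := phi_fun _ (in_range f i); exists k.
have /choice[n' hn'] k : exists i, phi (f i) = g k.
  by have [_ [i _ <-] e] := phi_surj _ (in_range g k); exists i.
have nK : cancel n n'.
  by move=> i; apply: f_inj; apply: phi_inj; rewrite ?inE //; rewrite hn' hn.
have n'K : cancel n' n by move=> k; apply: g_inj; rewrite hn hn'.
pose E i j := C01_dist (f i) (f j) < 2.
have fE : unit_graph E f by move=> i j; exact: C01_dist_lt.
have gE : unit_graph E (g \o n).
  move=> i j; rewrite /= -C01_dist_lt /E.
  (* The diagonal is treated apart: the common-neighbour criterion concerns distinct vertices. *)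
  have [->|ij] := pselect (i = j).
    by split=> _; apply/C01_dist_lt => x; rewrite subrr normr0.
  have nij : n i <> n j by move=> /(can_inj nK).
  rewrite (Gw i j ij) (Hw _ _ nij); split=> -[k [ik kj]].
    by exists (n k); rewrite !hn -!iso.
  by exists (n' k); rewrite !iso // -!hn n'K.
have gnd : dense_family (g \o n).
  move=> u e cu e0; have [k hk] := gd u e cu e0.
  by exists (n' k); rewrite /= n'K.
have [psi [b [hpsi mono]]] := same_unit_graph_homeomorphism fd fE gnd gE.
exists psi, n; split=> //; first by exists n'.
case: b mono => mono; [left|right] => i j x /mono /ltW //=.
by rewrite lerN2.
Qed.
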